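(* Let $f:\mathbb{R}^d\to\mathbb{R}^k$ and $h:\mathbb{R}^k\to\mathbb{R}$ be Lipschitz-continuous and smooth, with $h$ convex. Then for every stepsize $0\le\gamma\le 1/(2\ell_h L_f)$ and every point $w\in\mathbb{R}^d$, the Moreau gradient of $h\circ f$ at $w$ with stepsize $\gamma$ exists and is given by $$\nabla\operatorname{env}(\gamma\, h\circ f)(w)=\operatorname*{argmin}_{v\in\mathbb{R}^d}\left\{{\lambda^*}^\top f(w-v)+\tfrac12\|v\|_2^2\right\}=\nabla\operatorname{env}({\lambda^*}^\top f)(w),$$ where $$\lambda^*=\operatorname*{argmax}_{\lambda\in\mathbb{R}^k}\; -(\gamma h)^*(\lambda)+\operatorname{env}(\lambda^\top f)(w)$$ and $(\gamma h)^*$ is the convex conjugate of $\gamma h$.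
   Context: For $g:\mathbb{R}^n\to\mathbb{R}^m$, $\nabla g(x)\in\mathbb{R}^{n\times m}$ is the transpose of the Jacobian; $\ell_g=\sup_{x\neq y}\|g(x)-g(y)\|_2/\|x-y\|_2$ is the Lipschitz parameter of $g$, and $L_g=\sup_{x\ne y}\|\nabla g(x)-\nabla g(y)\|_2/\|x-y\|_2$ (spectral norm) is its smoothness parameter. ''Lipschitz-continuous'' means $\ell_g<\infty$; ''smooth'' means differentiable with $L_g<\infty$. For a real-valued $g:\mathbb{R}^d\to\mathbb{R}$ the Moreau envelope is $\operatorname{env}(g)(w)=\inf_{v\in\mathbb{R}^d}\{g(w-v)+\frac12\|v\|_2^2\}$ and the Moreau gradient is $\nabla\operatorname{env}(g)(w)=\operatorname{argmin}_{v\in\mathbb{R}^d}\{g(w-v)+\frac12\|v\|_2^2\}$ (the unique minimizer). So $\nabla\operatorname{env}(\gamma g)(w)$ is the Moreau gradient of $g$ at $w$ with stepsize $\gamma$. The objective $-(\gamma h)^*(\lambda)+\operatorname{env}(\lambda^\top f)(w)$ is understood to be $-\infty$ when $\lambda\notin\operatorname{dom}(\gamma h)^*$. *)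

(* Defs.v *)
From HB Require Import structures.
From mathcomp Require Import all_boot all_order all_algebra.
From mathcomp Require Import all_classical all_reals all_analysis.

Set Implicit Arguments.
Unset Strict Implicit.
Unset Printing Implicit Defensive.

Import Order.TTheory GRing.Theory Num.Theory.
Import numFieldNormedType.Exports.

Local Open Scope classical_set_scope.
Local Open Scope ring_scope.

(* Points of R^n are row vectors.  The norm that the library puts on 'rV[R]_n
   is the max norm; it is used below only through [differentiable] and the
   Jacobian, which do not depend on the choice of norm. *)

Definition dot (R : realType) (n : nat) (u v : 'rV[R]_n) : R :=
  \sum_(i < n) u 0 i * v 0 i.

Definition norm2 (R : realType) (n : nat) (u : 'rV[R]_n) : R :=
  Num.sqrt (\sum_(i < n) u 0 i ^+ 2).

(* Operator norm of the linear map u |-> u *m A on row vectors; a matrix and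
   its transpose have the same spectral norm. *)
Definition spectral_norm (R : realType) (m n : nat) (A : 'M[R]_(m, n)) : R :=
  sup [set norm2 (u *m A) | u in [set u : 'rV[R]_m | norm2 u <= 1]].

(* The supremum is taken in [0, +oo]: adding 0 matters only for n = 0, where
   there are no two distinct points. *)
Definition sup_slope (R : realType) (n : nat)
    (dist : 'rV[R]_n -> 'rV[R]_n -> R) : \bar R :=
  ereal_sup ([set 0%E] `|`
    [set (dist p.1 p.2 / norm2 (p.1 - p.2))%:E
       | p in [set p : 'rV[R]_n * 'rV[R]_n | p.1 <> p.2]]).

Definition lipschitz_param (R : realType) (n m : nat)
    (g : 'rV[R]_n -> 'rV[R]_m) : \bar R :=
  sup_slope (fun x y => norm2 (g x - g y)).

(* With row vectors, 'J g x is the n x m matrix whose (i, j) entry is the i-th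
   partial derivative of g_j, i.e. the transpose of the usual Jacobian. *)
Definition smoothness_param (R : realType) (n m : nat)
    (g : 'rV[R]_n -> 'rV[R]_m) : \bar R :=
  sup_slope (fun x y => spectral_norm ('J g x - 'J g y)).

Definition lipschitz_continuous (R : realType) (n m : nat)
    (g : 'rV[R]_n -> 'rV[R]_m) : Prop :=
  (lipschitz_param g < +oo)%E.

Definition smooth (R : realType) (n m : nat)
    (g : 'rV[R]_n -> 'rV[R]_m) : Prop :=
  (forall x, differentiable g x) /\ (smoothness_param g < +oo)%E.

(* A real-valued function as a function with values in R^1. *)
Definition to_rV1 (R : realType) (n : nat) (g : 'rV[R]_n -> R) :
    'rV[R]_n -> 'rV[R]_1 :=
  fun x => const_mx (g x).

Definition argmin (disp : Order.disp_t) (T : porderType disp) (U : Type)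
    (F : U -> T) : set U :=
  [set x | forall y, (F x <= F y)%O].

Definition argmax (disp : Order.disp_t) (T : porderType disp) (U : Type)
    (F : U -> T) : set U :=
  [set x | forall y, (F y <= F x)%O].

Definition moreau_objective (R : realType) (d : nat) (g : 'rV[R]_d -> R)
    (w v : 'rV[R]_d) : R :=
  g (w - v) + 2^-1 * norm2 v ^+ 2.

Definition env (R : realType) (d : nat) (g : 'rV[R]_d -> R)
    (w : 'rV[R]_d) : \bar R :=
  ereal_inf (range (fun v => (moreau_objective g w v)%:E)).

(* The Moreau gradient of g at w exists and is equal to v. *)
Definition is_moreau_gradient (R : realType) (d : nat) (g : 'rV[R]_d -> R)
    (w v : 'rV[R]_d) : Prop :=
  argmin (moreau_objective g w) = [set v].

Definition convex_conjugate (R : realType) (k : nat) (g : 'rV[R]_k -> R)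
    (lam : 'rV[R]_k) : \bar R :=
  ereal_sup (range (fun x => (dot lam x - g x)%:E)).

(* In \bar R, -oo absorbs addition on both sides (-oo + +oo = -oo), so the
   value is -oo whenever lam is outside the domain of the conjugate, whatever
   the envelope is there. *)
Definition dual_objective (R : realType) (d k : nat) (gamma : R)
    (h : 'rV[R]_k -> R) (f : 'rV[R]_d -> 'rV[R]_k) (w : 'rV[R]_d)
    (lam : 'rV[R]_k) : \bar R :=
  (- convex_conjugate (fun y => gamma * h y)%R lam
   + env (fun x => dot lam (f x)) w)%E.

(* Main.v *)
Require Import Defs.
From HB Require Import structures.
From mathcomp Require Import all_boot all_order all_algebra.
From mathcomp Require Import all_classical all_reals all_analysis.
From mathcomp Require Import ring lra.

Import Order.TTheory GRing.Theory Num.Theory.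
Import numFieldNormedType.Exports.

Local Open Scope classical_set_scope.
Local Open Scope ring_scope.

(** Write [g = gamma * h], [phi v = g (f (w - v)) + |v|^2 / 2] for the primal
    objective and [psi v = <lam, f (w - v)> + |v|^2 / 2] for the objective
    linearized at [lam].

    Since [h] and [f] are Lipschitz, [g (f (w - v))] decreases at most linearly
    in [|v|], so the quadratic term makes [phi] coercive and a minimizer [v]
    exists ([moreau_minimizer_exists]).  Take [lam] to be the gradient of [g] at
    [f (w - v)].  By the chain rule the first-order condition for [phi] at [v]
    ([moreau_minimizer_stationary]) is also the one for [psi] at [v].  The
    Lipschitz bound gives [|lam| <= gamma l_h], hence [<lam, f>] has a gradient
    with Lipschitz constant at most [gamma l_h L_f <= 1/2]; this curvature is
    dominated by that of [|v|^2 / 2], so a stationary point of [psi] is its only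
    minimizer ([moreau_stationary_argmin]).  Convexity of [g] gives
    [phi u - phi v >= psi u - psi v], which transfers uniqueness from [psi] to
    [phi].

    On the dual side, Fenchel-Young together with the definition of the envelope
    gives weak duality, with equality at this [lam] and [v] ([dual_value]).
    Conversely, equality at some [mu] forces equality in Fenchel-Young at
    [f (w - v)], that is, [mu] is a subgradient of [g] there
    ([tight_subgradient]).  As [g] is differentiable, its only subgradient is
    its gradient [lam] ([subgradient_eq_gradient]), so the dual maximizer is
    unique. *)

(** * Euclidean inner product and norm, suprema of slopes *)

Section Euclidean.
Local Set Implicit Arguments.
Local Unset Strict Implicit.
Variables (R : realType).
Implicit Types n : nat.

Lemma dotE n (u v : 'rV[R]_n) : dot u v = (u *m v^T) 0 0.
Proof. by rewrite mxE; apply: eq_bigr => i _; rewrite mxE. Qed.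

Lemma dotC n (u v : 'rV[R]_n) : dot u v = dot v u.
Proof. by apply: eq_bigr => i _; rewrite mulrC. Qed.

Lemma dotDr n (u v w : 'rV[R]_n) : dot u (v + w) = dot u v + dot u w.
Proof. by rewrite !dotE linearD mulmxDr mxE. Qed.

Lemma dotZr n a (u v : 'rV[R]_n) : dot u (a *: v) = a * dot u v.
Proof. by rewrite !dotE linearZ /= -scalemxAr mxE. Qed.

Lemma dotNr n (u v : 'rV[R]_n) : dot u (- v) = - dot u v.
Proof. by rewrite -scaleN1r dotZr mulN1r. Qed.

Lemma dotDl n (u v w : 'rV[R]_n) : dot (u + v) w = dot u w + dot v w.
Proof. by rewrite !(dotC _ w) dotDr. Qed.

Lemma dotZl n a (u v : 'rV[R]_n) : dot (a *: u) v = a * dot u v.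
Proof. by rewrite !(dotC _ v) dotZr. Qed.

Lemma norm2_ge0 n (u : 'rV[R]_n) : 0 <= norm2 u.
Proof. exact: sqrtr_ge0. Qed.

Lemma norm2_sqr n (u : 'rV[R]_n) : norm2 u ^+ 2 = dot u u.
Proof. by rewrite sqr_sqrtr // sumr_ge0 // => i _; rewrite sqr_ge0. Qed.

Lemma coord_le_norm2 n (u : 'rV[R]_n) i : `|u 0 i| <= norm2 u.
Proof.
rewrite -sqrtr_sqr ler_wsqrtr // (bigD1 i) //= lerDl sumr_ge0 // => j _.
by rewrite sqr_ge0.
Qed.

Lemma norm2_gt0 n (u : 'rV[R]_n) : u != 0 -> 0 < norm2 u.
Proof.
apply: contra_neqT; rewrite -leNgt => u0; apply/rowP => i; apply/eqP.
by rewrite mxE -normr_le0 (le_trans (coord_le_norm2 u i)).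
Qed.

Lemma norm20 n : norm2 (0 : 'rV[R]_n) = 0.
Proof.
by apply/eqP; rewrite -sqrf_eq0 norm2_sqr -(scale0r 0) dotZr mul0r.
Qed.

Lemma norm2Z n a (u : 'rV[R]_n) : norm2 (a *: u) = `|a| * norm2 u.
Proof.
rewrite /norm2 -sqrtr_sqr -sqrtrM ?sqr_ge0 // mulr_sumr.
by congr Num.sqrt; apply: eq_bigr => i _; rewrite mxE exprMn.
Qed.

Lemma norm2N n (u : 'rV[R]_n) : norm2 (- u) = norm2 u.
Proof. by rewrite -scaleN1r norm2Z normrN1 mul1r. Qed.

Lemma norm2D_sqr n (u v : 'rV[R]_n) :
  norm2 (u + v) ^+ 2 = norm2 u ^+ 2 + 2 * dot u v + norm2 v ^+ 2.
Proof. by rewrite !norm2_sqr dotDr !dotDl (dotC v u); ring. Qed.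

(** Cauchy-Schwarz, from the nonnegativity of the squared norm of
    [|v| u - |u| v]; scaling both vectors to the same length is what makes the
    cross term comparable to [|u| |v|]. *)
Lemma dot_le_norm2M n (u v : 'rV[R]_n) : dot u v <= norm2 u * norm2 v.
Proof.
have [->|u0] := eqVneq u 0.
  by rewrite norm20 dotC -(scale0r 0) dotZr !mul0r.
have [->|v0] := eqVneq v 0.
  by rewrite norm20 -(scale0r 0) dotZr mulr0 mul0r.
have {}u0 := norm2_gt0 u0; have {}v0 := norm2_gt0 v0.
have := norm2D_sqr (norm2 v *: u) (- (norm2 u *: v)).
rewrite norm2N !norm2Z !ger0_norm ?norm2_ge0 // dotNr dotZr dotZl.
set z := norm2 (_ - _); have : 0 <= z ^+ 2 by exact: sqr_ge0.
move=> z0 E; rewrite E in z0.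
rewrite -(ler_pM2l (mulr_gt0 u0 v0)); nra.
Qed.

Lemma norm2_const1 (a : R) : norm2 (const_mx a : 'rV[R]_1) = `|a|.
Proof. by rewrite /norm2 big_ord1 mxE sqrtr_sqr. Qed.

Lemma sup_slope_ge0 n (D : 'rV[R]_n -> 'rV[R]_n -> R) : (0 <= sup_slope D)%E.
Proof. by apply: ereal_sup_ubound; left. Qed.

Lemma le_sup_slope n (D : 'rV[R]_n -> 'rV[R]_n -> R) x y :
  (sup_slope D < +oo)%E -> D x x = 0 ->
  D x y <= fine (sup_slope D) * norm2 (x - y).
Proof.
move=> Dfin Dx; have [<-|xy] := eqVneq x y.
  by rewrite Dx subrr norm20 mulr0.
rewrite -ler_pdivrMr ?norm2_gt0 ?subr_eq0 //.
rewrite -lee_fin fineK ?ge0_fin_numE ?sup_slope_ge0 //.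
by apply: ereal_sup_ubound; right; exists (x, y) => //=; apply/eqP.
Qed.

(** The supremum defining the spectral norm is over a bounded set: on the unit
    ball the coordinates of [v] are at most 1, which bounds [v *m A]
    coordinatewise by the column sums of [|A|]. *)
Lemma norm2_mulmx_le m n (u : 'rV[R]_m) (A : 'M[R]_(m, n)) :
  norm2 (u *m A) <= spectral_norm A * norm2 u.
Proof.
have [->|u0] := eqVneq u 0; first by rewrite mul0mx !norm20 mulr0.
have {}u0 := norm2_gt0 u0.
rewrite -ler_pdivrMr //.
have -> : norm2 (u *m A) / norm2 u = norm2 (((norm2 u)^-1 *: u) *m A).
  by rewrite -scalemxAl norm2Z ger0_norm ?invr_ge0 ?norm2_ge0 // mulrC.
apply: ub_le_sup; last first.
  exists ((norm2 u)^-1 *: u) => //=.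
  by rewrite norm2Z ger0_norm ?invr_ge0 ?norm2_ge0 // mulVf // gt_eqF.
exists (Num.sqrt (\sum_j (\sum_i `|A i j|) ^+ 2)) => _ [v /= v1 <-].
rewrite ler_wsqrtr // ler_sum // => j _.
rewrite -[leLHS]real_normK ?num_real // lerXn2r ?nnegrE ?sumr_ge0 //.
rewrite mxE (le_trans (ler_norm_sum _ _ _)) //.
apply: ler_sum => i _; rewrite normrM ler_piMl //.
exact: le_trans (coord_le_norm2 v i) v1.
Qed.

End Euclidean.

(** * One-sided slopes and gradients *)

Section Calculus.
Local Set Implicit Arguments.
Local Unset Strict Implicit.
Variables (R : realType).
Implicit Types n : nat.

Lemma is_diff_dot n (a x : 'rV[R]_n) : is_diff x (dot a) (dot a).
Proof.
have lin : linear (dot a : 'rV[R]_n -> R^o).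
  by move=> c u v; rewrite dotDr dotZr.
pose L : {linear 'rV[R]_n -> R^o} :=
  HB.pack (dot a : _ -> R^o) (GRing.isLinear.Build _ _ _ _ _ lin).
have cL : continuous L.
  move=> y; apply: differentiable_continuous.
  have -> : (L : 'rV[R]_n -> R^o) =
      \sum_i (fun v : 'rV[R]_n => a 0 i * v 0 i : R^o).
    by apply/funext => v; rewrite fct_sumE.
  apply: differentiable_sum => i.
  apply: differentiableZ; exact: differentiable_coord.
apply: DiffDef; first exact: (linear_differentiable (f := L)).
exact: (diff_lin (f := L)).
Qed.

Lemma is_derive_line n (g : 'rV[R]_n -> R) (x u : 'rV[R]_n) (t : R) :
  differentiable g (x + t *: u) ->
  is_derive t 1 (fun s : R => g (x + s *: u)) ('d g (x + t *: u) u).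
Proof.
move=> dg.
have dl : is_diff t (fun s : R => x + s *: u) ( *:%R ^~ u).
  apply: is_diff_eq; rewrite add0r; exact: erefl.
have dc : is_diff t (g \o (fun s : R => x + s *: u))
    ('d g (x + t *: u) \o *:%R ^~ u).
  apply: is_diff_comp; apply: DiffDef => //.
apply: DeriveDef; first by apply: diff_derivable; case: dc.
by rewrite deriveE //= diff_val /= scale1r.
Qed.

(** The quadratic term disappears in the difference quotient as [s] tends to 0.
    This lemma and the next are the only passages to the limit: bounds on
    gradients, the subgradient inequality, the uniqueness of subgradients and
    the first-order condition are all instances of them. *)
Lemma diff_le_slope n (g : 'rV[R]_n -> R) (x u : 'rV[R]_n) (c b : R) :
  differentiable g x ->
  (forall s : R, 0 < s -> s <= 1 ->
    g (x + s *: u) - g x <= s * c + s ^+ 2 * b) ->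
  'd g x u <= c.
Proof.
move=> dg slope; rewrite -deriveE //.
have dgu : derivable g x u by exact: diff_derivable.
have lim_quot :
    h^-1 *: (g (h *: u + x) - g x) - h * b @[h --> 0^'+] --> 'D_u g x.
  rewrite -[X in _ --> X]subr0; apply: cvgB.
    exact: cvg_dnbhs_at_right dgu.
  rewrite -[X in _ --> X](mul0r b); apply: cvgMr_tmp.
  exact: cvg_at_right_filter.
apply: (cvgr_to_le lim_quot).
near=> s; have s0 : 0 < s by near: s; exact: nbhs_right_gt.
have s1 : s <= 1 by near: s; apply: nbhs_right_le.
have := slope s s0 s1; rewrite (addrC x) => le.
rewrite lerBlDr -[_ *: _]/(s^-1 * _) mulrC ler_pdivrMr //; lra.
Unshelve. all: by end_near.
Qed.

Lemma diff_ge_slope n (g : 'rV[R]_n -> R) (x u : 'rV[R]_n) (c b : R) :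
  differentiable g x ->
  (forall s : R, 0 < s -> s <= 1 ->
    s * c + s ^+ 2 * b <= g (x + s *: u) - g x) ->
  c <= 'd g x u.
Proof.
move=> dg slope.
have dNg : is_diff x (- g) (- ('d g x : _ -> _)).
  by apply: is_diffN; apply: DiffDef.
have : 'd (- g) x u <= - c.
  apply: (@diff_le_slope _ _ _ _ _ (- b)); first exact: ex_diff.
  move=> s s0 s1; have := slope s s0 s1.
  rewrite -[(- g) _]/(- g _) -[(- g) x]/(- g x); lra.
by rewrite diff_val; rewrite [X in X <= _]/(- 'd g x u) lerN2.
Qed.

Definition gradient n (g : 'rV[R]_n -> R) (x : 'rV[R]_n) : 'rV[R]_n :=
  \row_i 'd g x (delta_mx 0 i).

Lemma diff_dot_gradient n (g : 'rV[R]_n -> R) (x u : 'rV[R]_n) :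
  'd g x u = dot (gradient g x) u.
Proof.
rewrite {1}(row_sum_delta u) linear_sum; apply: eq_bigr => i _.
by rewrite linearZ mxE mulrC.
Qed.

(** The derivative in the direction of the gradient itself is the squared norm
    of the gradient, and the Lipschitz bound on slopes applies to it. *)
Lemma norm2_gradient_le n (g : 'rV[R]_n -> R) (x : 'rV[R]_n) (l : R) : 0 <= l ->
  differentiable g x -> (forall y, `|g y - g x| <= l * norm2 (y - x)) ->
  norm2 (gradient g x) <= l.
Proof.
move=> l0 dg lip; set a := gradient g x.
have [->|a0] := eqVneq a 0; first by rewrite norm20.
rewrite -(ler_pM2r (norm2_gt0 a0)) -expr2 norm2_sqr -diff_dot_gradient.
apply: (@diff_le_slope _ _ _ _ _ 0) => // s s0 _.
rewrite mulr0 addr0 (le_trans (ler_norm _)) // (le_trans (lip _)) //.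
by rewrite addrC addKr norm2Z gtr0_norm // mulrCA.
Qed.

(** By convexity the difference quotients of [g] at [x] in the direction
    [y - x] are at most [g y - g x]. *)
Lemma convex_gradient_le n (g : 'rV[R]_n -> R) (x y : 'rV[R]_n) :
  convex_function [set: convex_lmodType 'rV[R]_n] g -> differentiable g x ->
  g x + dot (gradient g x) (y - x) <= g y.
Proof.
move=> cvx dg; rewrite -lerBrDl -diff_dot_gradient.
apply: (@diff_le_slope _ _ _ _ _ 0) => // s s0 s1.
have s01 : Itv.spec (@Itv.num_sem R) (Itv.Real `[0%Z, 1%Z]) s.
  by rewrite /= /Itv.num_sem /= num_real /= in_itv /= (ltW s0) s1.
have := cvx (Itv.mk s01) y x (in_setT _) (in_setT _).
rewrite convRE => cvxs.
have {cvxs} le : g (s *: y + (1 - s) *: x) <= s * g y + (1 - s) * g x.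
  exact: cvxs.
have -> : x + s *: (y - x) = s *: y + (1 - s) *: x.
  by rewrite scalerBr scalerBl scale1r addrCA.
lra.
Qed.

(** A linear minorant of the increments bounds every directional derivative
    from below; applied to opposite directions the bounds become equalities. *)
Lemma subgradient_eq_gradient n (g : 'rV[R]_n -> R) (x a : 'rV[R]_n) :
  differentiable g x -> (forall y, g x + dot a (y - x) <= g y) ->
  a = gradient g x.
Proof.
move=> dg sub.
have le u : dot a u <= 'd g x u.
  apply: (@diff_ge_slope _ _ _ _ _ 0) => // s s0 _; have := sub (x + s *: u).
  rewrite [x + _ - x]addrAC subrr add0r dotZr; lra.
apply/rowP => i; apply/eqP; rewrite eq_le !mxE.
have e : a 0 i = dot a (delta_mx 0 i).
  rewrite /dot (bigD1 i) //= big1 ?mxE ?eqxx ?mulr1 ?addr0 // => j ji.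
  by rewrite mxE eqxx (negbTE ji) mulr0.
rewrite e le /=; have := le (- delta_mx 0 i).
by rewrite dotNr linearN lerN2.
Qed.

Lemma convex_functionZ k (h : 'rV[R]_k -> R) (gamma : R) :
  0 <= gamma -> convex_function [set: convex_lmodType 'rV[R]_k] h ->
  convex_function [set: convex_lmodType 'rV[R]_k] (fun y => gamma * h y).
Proof.
move=> gamma0 cvx t x y xT yT.
apply: le_trans (ler_wpM2l gamma0 (cvx t x y xT yT)) _.
by rewrite !convRE mulrDr !(mulrCA gamma).
Qed.

End Calculus.

(** * Minimizers of the Moreau objective *)

Section MoreauGradient.
Local Set Implicit Arguments.
Local Unset Strict Implicit.
Variables (R : realType) (n : nat).
Implicit Types (g : 'rV[R]_n -> R) (v w : 'rV[R]_n).

(** The quadratic term beats a linear decrease: outside the box of half-width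
    [2 |c|] the objective exceeds its value at 0, and the box is compact. *)
Lemma moreau_minimizer_exists g w (c : R) :
  (forall x, differentiable g x) ->
  (forall v, g w - g (w - v) <= c * norm2 v) ->
  exists v, argmin (moreau_objective g w) v.
Proof.
move=> g_diff g_growth.
pose r := 2 * `|c|.
pose box : set 'rV[R]_n := [set v | forall i, `[- r, r]%classic (v ord0 i)].
have cbox : compact box.
  by apply: (@rV_compact _ _ (fun=> `[- r, r]%classic)) => _;
    exact: segment_compact.
have r0 : 0 <= r by rewrite mulr_ge0.
have box0 : box 0 by move=> i /=; rewrite mxE in_itv /= oppr_le0 r0.
have cobj : continuous (moreau_objective g w).
  have -> : moreau_objective g w = (g \o (cst w - id)) +
      2^-1 *: \sum_i (fun u : 'rV[R]_n => u 0 i : R) ^+ 2.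
    apply/funext => u; rewrite -[RHS]/(g (w - u) + 2^-1 * _) fct_sumE.
    by rewrite /moreau_objective norm2_sqr.
  move=> v; apply: differentiable_continuous; apply: differentiableD.
    by apply: differentiable_comp => //; exact: differentiableB.
  apply: differentiableZ; apply: differentiable_sum => i.
  by apply: differentiableX; exact: differentiable_coord.
have [v _ vmin] : exists2 v, v \in box & forall u, u \in box ->
    moreau_objective g w v <= moreau_objective g w u.
  by apply: EVT_min_rV => //; [exists 0|exact: continuous_subspaceT].
exists v => u /=; have [/mem_set/vmin//|/existsNP[i ui]] := pselect (box u).
apply: (le_trans (vmin 0 (mem_set box0))).
have ru : r < norm2 u.
  rewrite ltNge; apply/negP => nu; apply: ui => /=.
  by rewrite in_itv /= -ler_norml (le_trans (coord_le_norm2 u i)).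
rewrite /moreau_objective subr0 norm20.
have cu : c <= 2^-1 * norm2 u.
  rewrite /r in ru; have := ler_norm c; lra.
have := g_growth u; have := ler_wpM2r (norm2_ge0 u) cu; lra.
Qed.

(** Moving the minimizer [v] to [v - s u] moves the argument of [g] by [s u] and
    changes the quadratic term by [- s <v, u>] up to order [s^2]. *)
Lemma moreau_minimizer_stationary g w v :
  differentiable g (w - v) -> argmin (moreau_objective g w) v ->
  forall u, 'd g (w - v) u = dot v u.
Proof.
move=> dg vmin.
have le u : dot v u <= 'd g (w - v) u.
  apply: (@diff_ge_slope _ _ _ _ _ _ (- (2^-1 * norm2 u ^+ 2))) => // s s0 _.
  have := vmin (v - s *: u); rewrite /moreau_objective.
  rewrite norm2D_sqr norm2N norm2Z dotNr dotZr exprMn real_normK ?num_real //.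
  rewrite opprB addrCA [s *: u + _]addrC; lra.
move=> u; apply/eqP; rewrite eq_le le andbT -lerN2 -dotNr -linearN; exact: le.
Qed.

(** The objective is in fact strongly convex, but strict minimality already
    follows from the mean value theorem along the segment from [v] to [u]: the
    intermediate point lies at a fraction [t < 1] of the segment, so the
    gradient deviates by at most [t L |u - v|] with [t L < 1/2], and the
    quadratic term gains [|u - v|^2 / 2]. *)
Lemma moreau_stationary_argmin g w v (L : R) : L <= 2^-1 ->
  (forall x, differentiable g x) ->
  (forall x y u, 'd g x u - 'd g y u <= L * norm2 (x - y) * norm2 u) ->
  (forall u, 'd g (w - v) u = dot v u) ->
  is_moreau_gradient g w v.
Proof.
move=> L2 dg dgL stat.
have lt u : u != v -> moreau_objective g w v < moreau_objective g w u.
  move=> uv; pose e := u - v.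
  have e0 : 0 < norm2 e by rewrite norm2_gt0 // subr_eq0.
  pose phi (s : R) := g (w - v + s *: - e).
  have dphi (t : R) : is_derive t 1 phi ('d g (w - v + t *: - e) (- e)).
    exact: is_derive_line.
  have cphi : {within `[0, 1], continuous phi}.
    by apply: derivable_within_continuous => t _; exact: ex_derive.
  have [t /[!in_itv] /= /andP[t0 t1] gE] := MVT ltr01 (fun t _ => dphi t) cphi.
  (* The intermediate point is kept abstract: the remaining computation depends
     only on its distance to [w - v]. *)
  have [y [{}gE yE]] : exists y, g (w - u) - g (w - v) = - 'd g y e /\
      norm2 (y - (w - v)) = t * norm2 e.
    exists (w - v + t *: - e); split.
      rewrite -linearN; move: gE.
      rewrite /phi scale1r scale0r addr0 subr0 mulr1.
      by rewrite opprB addrA subrK.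
    by rewrite addrC addKr norm2Z norm2N gtr0_norm.
  have dgE : 'd g y e - dot v e <= L * (t * norm2 e) * norm2 e.
    by rewrite -yE -(stat e); exact: dgL.
  rewrite /moreau_objective.
  have -> : norm2 u ^+ 2 = norm2 v ^+ 2 + 2 * dot v e + norm2 e ^+ 2.
    by rewrite -norm2D_sqr /e addrC subrK.
  have Lt : L * t < 2^-1.
    by have := ler_wpM2r (ltW t0) L2; lra.
  have : (L * t) * norm2 e ^+ 2 < 2^-1 * norm2 e ^+ 2.
    by rewrite ltr_pM2r ?exprn_gt0.
  lra.
apply/seteqP; split => [u /= umin|_ ->]; last first.
  by move=> u; have [->|/lt/ltW] := eqVneq u v.
by apply/eqP; apply: contraT => /lt; rewrite ltNge umin.
Qed.

End MoreauGradient.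

(** * Consequences of finite Lipschitz and smoothness parameters *)

Section FiniteSlopes.
Local Set Implicit Arguments.
Local Unset Strict Implicit.
Variables (R : realType).

Lemma lipschitz_le n m (g : 'rV[R]_n -> 'rV[R]_m) x y :
  lipschitz_continuous g ->
  norm2 (g x - g y) <= fine (lipschitz_param g) * norm2 (x - y).
Proof.
move=> gL; apply: (@le_sup_slope _ _ (fun x y => norm2 (g x - g y)) x y) => //.
by rewrite subrr norm20.
Qed.

Lemma lipschitz_rV1_le n (h : 'rV[R]_n -> R) x y :
  lipschitz_continuous (to_rV1 h) ->
  `|h x - h y| <= fine (lipschitz_param (to_rV1 h)) * norm2 (x - y).
Proof.
move=> hL; rewrite -norm2_const1.
have -> : const_mx (h x - h y) = to_rV1 h x - to_rV1 h y.
  by apply/rowP => i; rewrite !mxE.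
exact: lipschitz_le.
Qed.

Lemma differentiable_rV1 n (h : 'rV[R]_n -> R) x :
  differentiable (to_rV1 h) x -> differentiable h x.
Proof.
move=> dh; have -> : h = (fun M : 'rV[R]_1 => M 0 0 : R) \o to_rV1 h.
  by apply/funext => y; rewrite /= mxE.
by apply: differentiable_comp => //; exact: differentiable_coord.
Qed.

Lemma spectral_norm0 m n : spectral_norm (0 : 'M[R]_(m, n)) = 0.
Proof.
rewrite /spectral_norm (_ : [set _ | _ in _] = [set 0]) ?sup1 //.
apply/seteqP; split => [_ [u _ <-]|_ ->] /=; first by rewrite mulmx0 norm20.
by exists 0; rewrite /= ?mulmx0 norm20.
Qed.

Lemma smooth_diff_le n m (f : 'rV[R]_n -> 'rV[R]_m) x y u : smooth f ->
  norm2 ('d f x u - 'd f y u) <=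
    fine (smoothness_param f) * norm2 (x - y) * norm2 u.
Proof.
move=> [df fL].
have dJ z : 'd f z u = u *m 'J f z by rewrite -deriveEjacobian // deriveE.
have -> : 'd f x u - 'd f y u = u *m ('J f x - 'J f y).
  by rewrite mulmxBr; congr (_ - _); exact: dJ.
apply: le_trans (norm2_mulmx_le _ _) _.
apply: ler_wpM2r; first exact: norm2_ge0.
pose D x y := spectral_norm ('J f x - 'J f y).
apply: (@le_sup_slope _ _ D x y) => //.
by rewrite /D subrr spectral_norm0.
Qed.

(** When the product of the two parameters vanishes the stepsize is
    unconstrained, but the conclusion is then trivial. *)
Lemma stepsize_bound (a b : \bar R) (gamma : R) :
  (0 <= a)%E -> (0 <= b)%E -> (a < +oo)%E -> (b < +oo)%E ->
  (gamma%:E <= 1 / (2%:E * a * b))%E -> gamma * fine a * fine b <= 2^-1.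
Proof.
move: a b => [a||] [b||] //; rewrite !lee_fin => a0 b0 _ _ /=.
have [ab|ab] := eqVneq (a * b) 0.
  by move=> _; rewrite -mulrA ab mulr0 invr_ge0.
have {}ab : 0 < 2 * a * b by rewrite -mulrA mulr_gt0 // lt_def ab mulr_ge0.
rewrite -!EFinM inver gt_eqF // -EFinM lee_fin mul1r -[_^-1]mul1r.
rewrite ler_pdivlMr //; lra.
Qed.

End FiniteSlopes.

(** * Fenchel duality for the composite problem *)

Section Duality.
Local Set Implicit Arguments.
Local Unset Strict Implicit.
Variables (R : realType) (d k : nat) (gamma : R).
Variables (h : 'rV[R]_k -> R) (f : 'rV[R]_d -> 'rV[R]_k) (w : 'rV[R]_d).
Implicit Types (lam : 'rV[R]_k) (v : 'rV[R]_d).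

(** Fenchel-Young at an arbitrary point [y], kept independent of [v]: weak
    duality is the case [y = f (w - v)], while the subgradient property of a
    tight multiplier needs every [y]. *)
Lemma dual_objective_le lam v y :
  (dual_objective gamma h f w lam <=
     (gamma * h y - dot lam y +
      moreau_objective (fun x => dot lam (f x)) w v)%:E)%E.
Proof.
rewrite EFinD; apply: leeD; last by apply: ereal_inf_lbound; exists v.
by rewrite leeNl -EFinN opprB; apply: ereal_sup_ubound; exists y.
Qed.

Lemma weak_duality lam v :
  (dual_objective gamma h f w lam <=
     (moreau_objective (fun x => gamma * h (f x)) w v)%:E)%E.
Proof.
apply: le_trans (dual_objective_le lam v (f (w - v))) _.
rewrite lee_fin /moreau_objective; lra.
Qed.

(** A subgradient attains equality in Fenchel-Young, and a minimizer of the
    linearized objective attains the envelope, so the duality gap closes. *)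
Lemma dual_value lam v :
  (forall y, gamma * h (f (w - v)) + dot lam (y - f (w - v)) <= gamma * h y) ->
  argmin (moreau_objective (fun x => dot lam (f x)) w) v ->
  dual_objective gamma h f w lam =
    (moreau_objective (fun x => gamma * h (f x)) w v)%:E.
Proof.
move=> sub vmin; apply/eqP; rewrite eq_le weak_duality /=.
rewrite (_ : moreau_objective (fun x => gamma * h (f x)) w v =
    gamma * h (f (w - v)) - dot lam (f (w - v)) +
    moreau_objective (fun x => dot lam (f x)) w v); last first.
  by rewrite /moreau_objective; lra.
rewrite EFinD; apply: leeD; last first.
  by apply: le_ereal_inf_tmp => _ [u _ <-]; rewrite lee_fin; exact: vmin.
rewrite leeNr -EFinN opprB; apply: ge_ereal_sup => _ [y _ <-]; rewrite lee_fin.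
have := sub y; rewrite dotDr dotNr; lra.
Qed.

(** With no duality gap, the terms of the dual bound that come from the envelope
    cancel and leave exactly the subgradient inequality. *)
Lemma tight_subgradient lam v :
  ((moreau_objective (fun x => gamma * h (f x)) w v)%:E <=
     dual_objective gamma h f w lam)%E ->
  forall y, gamma * h (f (w - v)) + dot lam (y - f (w - v)) <= gamma * h y.
Proof.
move=> tight y.
have := le_trans tight (dual_objective_le lam v y).
rewrite lee_fin /moreau_objective dotDr dotNr; lra.
Qed.

End Duality.

(* The quotient in the stepsize bound is taken in \bar R, where 1 / 0 = +oo. *)
Theorem lemma2p1 (R : realType) (d k : nat)
    (f : 'rV[R]_d -> 'rV[R]_k) (h : 'rV[R]_k -> R)
    (f_lipschitz : lipschitz_continuous f) (f_smooth : smooth f)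
    (h_lipschitz : lipschitz_continuous (to_rV1 h))
    (h_smooth : smooth (to_rV1 h))
    (h_convex : convex_function [set: convex_lmodType 'rV[R]_k] h)
    (gamma : R) (gamma_ge0 : 0 <= gamma)
    (gamma_le : (gamma%:E <=
       1 / (2%:E * lipschitz_param (to_rV1 h) * smoothness_param f))%E)
    (w : 'rV[R]_d) :
  exists (lam : 'rV[R]_k) (v : 'rV[R]_d),
    [/\ argmax (dual_objective gamma h f w) = [set lam],
        is_moreau_gradient (fun x => gamma * h (f x)) w v,
        argmin (fun u : 'rV[R]_d =>
          dot lam (f (w - u)) + 2^-1 * norm2 u ^+ 2) = [set v]
      & is_moreau_gradient (fun x => dot lam (f x)) w v].
Proof.
pose g y := gamma * h y; pose l := gamma * fine (lipschitz_param (to_rV1 h)).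
have df x : differentiable f x by case: f_smooth.
have dg y : differentiable g y.
  by apply: differentiableZ; apply: differentiable_rV1; case: h_smooth.
have g_lip x y : `|g x - g y| <= l * norm2 (x - y).
  rewrite -mulrBr normrM ger0_norm // -mulrA ler_wpM2l //.
  exact: lipschitz_rV1_le.
have l_ge0 : 0 <= l by rewrite mulr_ge0 // fine_ge0 // sup_slope_ge0.
have [v vmin] : exists v, argmin (moreau_objective (g \o f) w) v.
  apply: (@moreau_minimizer_exists _ _ _ _ (l * fine (lipschitz_param f))).
    by move=> x; exact: differentiable_comp.
  move=> v; apply: le_trans (ler_norm _) _; apply: le_trans (g_lip _ _) _.
  rewrite -mulrA ler_wpM2l //; apply: le_trans (lipschitz_le _ _ f_lipschitz) _.
  by rewrite opprB addrC subrK.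
pose lam := gradient g (f (w - v)).
have lam_le : norm2 lam <= l by apply: norm2_gradient_le.
have sub y : g (f (w - v)) + dot lam (y - f (w - v)) <= g y.
  by apply: convex_gradient_le => //; exact: convex_functionZ.
pose F := dot lam \o f.
have F_diff x : is_diff x F (dot lam \o 'd f x).
  by apply: is_diff_comp; [exact: DiffDef|exact: is_diff_dot].
have dF x : differentiable F x by case: (F_diff x).
have dFE x u : 'd F x u = dot lam ('d f x u) by rewrite diff_val.
have vF : is_moreau_gradient F w v.
  apply: (@moreau_stationary_argmin _ _ _ _ _
    (l * fine (smoothness_param f))) => //.
  - apply: stepsize_bound gamma_le => //; try exact: sup_slope_ge0.
    exact: f_smooth.2.
  - move=> x y u.
    have -> : 'd F x u - 'd F y u = dot lam ('d f x u - 'd f y u).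
      by rewrite dotDr dotNr; congr (_ - _); exact: dFE.
    apply: le_trans (dot_le_norm2M _ _) _; rewrite -mulrA -mulrA.
    apply: ler_pM; [exact: norm2_ge0|exact: norm2_ge0|exact: lam_le|].
    by rewrite mulrA; exact: smooth_diff_le.
  - (* chain rule: [F] and [g \o f] have the same differential at [w - v] *)
    move=> u; rewrite dFE -diff_dot_gradient.
    have dG : 'd (g \o f) (w - v) u = 'd g (f (w - v)) ('d f (w - v) u).
      by rewrite diff_comp.
    apply: etrans (esym dG) _; apply: moreau_minimizer_stationary vmin _.
    exact: differentiable_comp.
have vFmin : argmin (moreau_objective F w) v by rewrite vF.
exists lam, v; split => //.
- (* any dual maximizer is tight, hence a subgradient of [g] *)
  apply/seteqP; split => [mu mu_max|_ -> mu]; last first.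
    by rewrite (dual_value sub vFmin) weak_duality.
  apply: subgradient_eq_gradient => // y; apply: tight_subgradient.
  by rewrite -(dual_value sub vFmin); exact: mu_max.
- (* [phi u <= phi v] implies [psi u <= psi v], and [psi] has one minimizer *)
  apply/seteqP; split => [u umin|_ ->//].
  rewrite -vF => y; apply: le_trans (vFmin y).
  have := umin v; rewrite /moreau_objective /=.
  have := sub (f (w - u)); rewrite dotDr dotNr /F /g /=; lra.
Qed.
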